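(* Let $k\ge 2$ be fixed ($k\ge 3$ in the case of the cycle $C_k$). For each $G\in\{C_k,P_k,S_k\}$, as $n\to\infty$, $$\frac{2^n}{2(k-1)}(1-o(1))\le f(n,G)\le \frac{2^n}{2(k-1)}(1+o(1)).$$
   Context: $[n]=\{1,\dots,n\}$ and $\mathcal{P}(n)$ is the set of all subsets of $[n]$. $C_k$, $P_k$, $S_k$ denote the cycle, path, and star with $k$ edges, respectively. For a graph $G$, a hypergraph $H$ is called Berge-$G$ if there is a copy of $G$ with $V(G)\subseteq V(H)$ and a bijection $g:E(G)\to E(H)$ such that $e\subseteq g(e)$ for every $e\in E(G)$. A family of subsets of $[n]$ (viewed as a hypergraph with vertex set $[n]$) is $G$-free if it contains no subfamily that is a Berge-$G$ hypergraph. $f(n,G)$ denotes the smallest number of colors in a coloring (partition) of $\mathcal{P}(n)$ such that every color class is $G$-free. *)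

(* Defs.v *)
From mathcomp Require Import all_boot.

Set Implicit Arguments.
Unset Strict Implicit.
Unset Printing Implicit Defensive.

Record sgraph := SGraph {
  vertex :> finType;
  adj : rel vertex;
  adj_sym : symmetric adj;
  adj_irr : irreflexive adj }.

Definition edges (G : sgraph) : {set {set G}} :=
  [set [set p.1; p.2] | p : G * G & adj p.1 p.2].

Definition cycle_adj (k : nat) : rel 'I_k :=
  fun i j => (i != j) && ((j == ordS i) || (i == ordS j)).

Lemma cycle_adj_sym k : symmetric (@cycle_adj k).
Proof. by move=> i j; rewrite /cycle_adj eq_sym orbC. Qed.

Lemma cycle_adj_irr k : irreflexive (@cycle_adj k).
Proof. by move=> i; rewrite /cycle_adj eqxx. Qed.

(* The cycle with k edges on the vertices 0, ..., k-1, for k >= 3; for smaller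
   k the value is a junk graph with fewer than k edges. *)
Definition cycle_graph (k : nat) : sgraph :=
  SGraph (@cycle_adj_sym k) (@cycle_adj_irr k).

Definition path_adj (k : nat) : rel 'I_k.+1 :=
  fun i j => (i.+1 == j :> nat) || (j.+1 == i :> nat).

Lemma path_adj_sym k : symmetric (@path_adj k).
Proof. by move=> i j; rewrite /path_adj orbC. Qed.

Lemma path_adj_irr k : irreflexive (@path_adj k).
Proof. by move=> i; rewrite /path_adj orbb gtn_eqF. Qed.

(* The path with k edges, hence k+1 vertices. *)
Definition path_graph (k : nat) : sgraph :=
  SGraph (@path_adj_sym k) (@path_adj_irr k).

Definition star_adj (k : nat) : rel 'I_k.+1 :=
  fun i j => (i == ord0) != (j == ord0).

Lemma star_adj_sym k : symmetric (@star_adj k).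
Proof. by move=> i j; rewrite /star_adj eq_sym. Qed.

Lemma star_adj_irr k : irreflexive (@star_adj k).
Proof. by move=> i; rewrite /star_adj eqxx. Qed.

(* The star with k edges: centre 0 and leaves 1, ..., k. *)
Definition star_graph (k : nat) : sgraph :=
  SGraph (@star_adj_sym k) (@star_adj_irr k).

(* A hypergraph with vertex set W is its set of hyperedges.  The copy of G is
   given by the injection phi of its vertices into W, and g is only relevant on
   the edges of G. *)
Definition berge (G : sgraph) (W : finType) (H : {set {set W}}) : bool :=
  [exists phi : {ffun G -> W}, exists g : {ffun {set G} -> {set W}},
    [&& injectiveb phi,
        dinjectiveb g (edges G),
        g @: edges G == H
      & [forall e in edges G, phi @: e \subset g e]]].

Definition berge_free (G : sgraph) (W : finType) (F : {set {set W}}) : bool :=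
  [forall H : {set {set W}}, (H \subset F) ==> ~~ berge G H].

Definition free_partition (G : sgraph) (n : nat)
    (P : {set {set {set 'I_n}}}) : bool :=
  partition P [set: {set 'I_n}] && [forall F in P, berge_free G F].

(* The default value 2 ^ n of the minimum is harmless as soon as G has at least
   two edges: see min_colorsP below. *)
Definition min_colors (n : nat) (G : sgraph) : nat :=
  \big[minn/2 ^ n]_(P : {set {set {set 'I_n}}} | free_partition G P) #|P|.

Lemma min_colors_le (n : nat) (G : sgraph) (P : {set {set {set 'I_n}}}) :
  free_partition G P -> min_colors n G <= #|P|.
Proof.
move=> hP; rewrite /min_colors.
have := mem_index_enum P; elim: (index_enum _) => // Q r IH.
rewrite inE big_cons => /orP[/eqP <-|/IH le_r]; first by rewrite hP geq_minl.
by case: ifP => // _; rewrite geq_min le_r orbT.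
Qed.

Lemma min_colorsP (n : nat) (G : sgraph) : 1 < #|edges G| ->
  exists2 P : {set {set {set 'I_n}}},
    free_partition G P & #|P| = min_colors n G.
Proof.
move=> hG; rewrite /min_colors.
elim/big_ind: _ => [|x y [P hP hx] [Q hQ hy]|P hP]; last by exists P.
  exists [set [set A] | A in [set: {set 'I_n}]].
    apply/andP; split.
      have tI : trivIset [set [set A] | A : {set 'I_n} in [set: {set 'I_n}]].
        apply/trivIsetP => _ _ /imsetP[A _ ->] /imsetP[B _ ->] hAB.
        by rewrite disjoints1 inE; apply: contraNN hAB => /eqP ->.
      rewrite /partition tI /=; apply/andP; split.
        rewrite eqEsubset subsetT; apply/subsetP => A _.
        by apply/bigcupP; exists [set A]; rewrite ?imset_f ?inE.
      by apply/imsetP => -[A _ /setP/(_ A)]; rewrite !inE eqxx.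
    apply/forall_inP => _ /imsetP[A _ ->]; apply/forall_inP => H hH.
    apply/existsP => -[phi /existsP[g /and4P[_ /dinjectiveP gI /eqP gH _]]].
    have := subset_leq_card hH; rewrite cards1 -gH card_in_imset //.
    by rewrite leqNgt hG.
  rewrite card_imset; last exact: set1_inj.
  by rewrite -powersetT card_powerset cardsT card_ord.
by case: (leqP x y) => _; [exists P | exists Q].
Qed.

(* Main.v *)
Require Import Defs.
From mathcomp Require Import all_boot all_order all_algebra.
From mathcomp Require Import zify ring.
Set Implicit Arguments.
Unset Strict Implicit.
Unset Printing Implicit Defensive.

(** Cycles, paths and stars enter only through three facts: such a graph [G] has
exactly [k] edges, at most [k + 1] vertices, and is connected.

Upper bound ([min_colors_upper]).  Split the subsets of an [(m + 1)]-set into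
those that contain a fixed point and those that do not, and decompose the
subsets of the other [m] points into ['C(m, m./2)] chains.  On the first side
each chain is cut into blocks of [k - 1] consecutive sets; on the second side the
complements of the sets of the chain are cut in the same way, and a block of
complements gets the color of the block just below it in the chain.  If [A] lies
in the lower block and [B] is the complement of a set of the upper block, then
[A] and [B] are disjoint.  So a color class consists of two mutually disjoint
sides of at most [k - 1] sets each, and a connected graph with [k] edges has no
Berge copy there, since all its hyperedges would lie on one side
([berge_free_two_sides]).  Up to a bounded loss per chain this takes
[2 ^ m / (k - 1)] colors, and the number of chains is negligible because
['C(m, m./2)] is at most [2 ^ m / sqrt (m + 1)] ([central_binomial]).

Lower bound ([min_colors_lower]).  Any [2k - 1] sets of size at least
[n / 2 - n / 4k] have total size at least [(k - 1) n + n / 4k], so linearly many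
points lie in [k] of them; by pigeonhole some [k] of these sets share more than
[k] points once [n] is large, and they then form a Berge copy of every graph with
[k] edges and at most [k + 1] vertices ([berge_common_core]).  Hence a color
class holds at most [2 (k - 1)] sets of that size, while by Chebyshev's
inequality only a [4 k ^ 2 / n] fraction of all sets is smaller
([card_small_sets]). *)

(** * Decomposition of a power set into few chains *)

Lemma perm_enum_powersetU1 (T : finType) (a : T) (D : {set T}) : a \notin D ->
  perm_eq (enum (powerset (a |: D)))
          (enum (powerset D) ++ [seq a |: x | x <- enum (powerset D)]).
Proof.
move=> aD.
have aI : {in enum (powerset D) &, injective (setU [set a])}.
  move=> x y; rewrite !mem_enum !inE => /subsetP xD /subsetP yD /setP xy.
  apply/setP => z; have := xy z; rewrite !inE.
  case: eqP => [-> _|//].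
  by rewrite (contraNF (xD a) aD) (contraNF (yD a) aD).
apply: uniq_perm; first exact: enum_uniq.
  rewrite cat_uniq enum_uniq map_inj_in_uniq // enum_uniq andbT /=.
  apply/hasPn => _ /mapP[x _ ->]; rewrite mem_enum inE.
  by apply/negP => /subsetP/(_ a); rewrite setU11 (negPf aD) => /(_ isT).
move=> x; rewrite mem_cat !mem_enum inE; apply/idP/orP => [xD|].
  case ax : (a \in x); [right | left].
    apply/mapP; exists (x :\ a); last by rewrite setD1K.
    by rewrite mem_enum inE subDset.
  rewrite inE; apply/subsetP => z zx; have := subsetP xD z zx.
  by rewrite !inE => /orP[/eqP za|//]; rewrite -za zx in ax.
case=> [|/mapP[y]]; rewrite ?mem_enum inE => yD.
  exact: subset_trans yD (subsetUr _ _).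
by move=> ->; apply: setUS.
Qed.

(** The inductive construction of de Bruijn, Tengbergen and Kruyswijk: with a new
point [a], the chain [x_1, ..., x_l] gives [x_1, ..., x_l, a |: x_l] and
[a |: x_1, ..., a |: x_(l-1)], the second of which may be empty.  The cardinals
along a chain are consecutive and symmetric about [#|D| / 2]. *)
Lemma symmetric_chains (T : finType) (D : {set T}) :
  exists2 cs : seq (seq {set T}),
    perm_eq (flatten cs) (enum (powerset D)) &
    {in cs, forall c, sorted (fun x y : {set T} => x \subset y) c /\
       exists2 a, [seq #|x : {set T}| | x <- c] = iota a (size c) &
         0 < size c /\ a.*2 + size c = #|D|.+1}.
Proof.
have [d] := ubnP #|D|; elim: d => // d IH in D *.
have [->|[a aD]] := set_0Vmem D => [_|].
  exists [:: [:: set0]].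
    by rewrite powerset0 enum_set1.
  move=> c; rewrite inE => /eqP ->; split=> //.
  by exists 0; rewrite /= cards0.
rewrite ltnS => dD.
have DE : D = a |: (D :\ a) by rewrite setD1K.
have cD := cardsD1 a D; rewrite aD add1n in cD.
case: (IH (D :\ a)) => [|cs csD csP]; first by rewrite -ltnS -cD ltnS.
have aD' : a \notin D :\ a by rewrite !inE eqxx.
have cW c x : c \in cs -> x \in c -> a \notin x.
  move=> c_cs xc; have: x \in enum (powerset (D :\ a)).
    by rewrite -(perm_mem csD); apply/flattenP; exists c.
  by rewrite mem_enum inE; apply: contraTN => ax; apply/subsetPn; exists a.
pose up c := rcons c (a |: last set0 c).
pose dn (c : seq {set T}) := [seq a |: x | x <- take (size c).-1 c].
(* The empty chains among the [dn c] must be dropped: they have no middle set. *)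
exists ([seq up c | c <- cs] ++ [seq c <- [seq dn c | c <- cs] | c != [::]]).
  rewrite flatten_cat [enum _](_ : _ = enum (powerset (a |: (D :\ a)))); last by rewrite -DE.
  apply: perm_trans _ _; last by rewrite perm_sym; exact: perm_enum_powersetU1.
  have -> : flatten [seq c <- [seq dn c | c <- cs] | c != [::]] = flatten [seq dn c | c <- cs].
    by elim: (map dn cs) => //= c s IHs; case: eqP => [->|] /=; rewrite IHs.
  apply: perm_trans (perm_cat csD (perm_map _ csD)).
  have: {in cs, forall c, c != [::]}.
    by move=> c /csP[_ [b _ [+ _]]]; case: c.
  elim: cs {csD csP cW} => //= c s IHs ne.
  have /IHs {}IHs: {in s, forall c, c != [::]} by move=> x xs; apply: ne; rewrite inE xs orbT.
  have cE : [seq a |: x | x <- c] = rcons (dn c) (a |: last set0 c).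
    have := ne c (mem_head _ _); case/lastP: c {ne} => // c x _.
    by rewrite /dn size_rcons last_rcons map_rcons -[in take _ _]cats1 take_size_cat.
  rewrite map_cat cE.
  apply/permP => p; have /permP/(_ p) := IHs.
  rewrite /up -!cats1 !count_cat /= => E; lia.
have szE c : 0 < size c -> size (dn c) = (size c).-1.
  by move=> c0; rewrite size_map size_take; case: ltnP => //; lia.
move=> z; rewrite mem_cat => /orP[/mapP[c c_cs ->]|].
  have [so [b bE [c0 bs]]] := csP c c_cs; split.
    case/lastP: c c_cs so bE c0 bs => // c x c_cs so _ _ _.
    rewrite /up last_rcons.
    case: c so {c_cs} => [|y c]; rewrite /= ?subsetUr //.
    by rewrite [path _ _ (rcons (rcons _ _) _)]rcons_path last_rcons => ->; rewrite subsetUr.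
  exists b; rewrite /up size_rcons ?cD; last by split=> //; lia.
  rewrite map_rcons bE -addn1 iotaD /= -cats1; congr (_ ++ [:: _]).
  rewrite cardsU1 (cW c) //; last by case: c c0 {c_cs so bE bs} => //= y c _; rewrite mem_last.
  have -> : #|last set0 c| = last 0 (map (fun x : {set T} => #|x|) c).
    by case: c c0 {c_cs so bE bs} => //= y c _; rewrite last_map.
  rewrite bE; case: (size c) c0 => // m _.
  by rewrite -addn1 iotaD last_cat /=; lia.
rewrite mem_filter => /andP[zn /mapP[c c_cs E]]; rewrite E in zn *.
have [so [b bE [c0 bs]]] := csP c c_cs.
have sd := szE c c0.
have d0 : 0 < size (dn c) by case: (dn c) zn.
split.
  rewrite /dn sorted_map.
  by apply: sub_sorted (take_sorted _ so) => x y xy /=; apply: setUS.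
exists b.+1; last by split=> //; rewrite cD; lia.
have -> : [seq #|x : {set T}| | x <- dn c] = map S (take (size c).-1 (map (fun x : {set T} => #|x|) c)).
  rewrite -map_take /dn -!map_comp; apply/eq_in_map => x /mem_take xc /=.
  by rewrite cardsU1 (cW c).
rewrite bE sd take_iota; have -> : minn (size c).-1 (size c) = (size c).-1 by lia.
by rewrite -[b.+1]add1n iotaDl; apply: eq_map => i; rewrite add1n.
Qed.

(** By symmetry each chain has exactly one member of cardinal [#|D|./2], so there
are as many chains as subsets of that cardinal. *)
Lemma chain_decomposition (T : finType) (D : {set T}) :
  exists cs : seq (seq {set T}),
  [/\ perm_eq (flatten cs) (enum (powerset D)),
      size cs = 'C(#|D|, #|D|./2) &
      {in cs, forall c, sorted (fun x y : {set T} => x \subset y) c}].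
Proof.
have [cs csD csP] := symmetric_chains D; exists cs; split=> // [|c /csP[]//].
pose p := fun x : {set T} => #|x| == #|D|./2.
have /permP/(_ p) := csD; rewrite count_flatten.
have -> : [seq count p c | c <- cs] = nseq (size cs) 1.
  rewrite -[size cs](size_map (count p)); apply/all_pred1P; rewrite all_map; apply/allP => c /csP[_ [a aE [c0 ac]]] /=.
  have -> : count p c = count_mem #|D|./2 (map (fun x : {set T} => #|x|) c) by rewrite count_map.
  rewrite aE; apply/eqP; rewrite count_uniq_mem ?iota_uniq // mem_iota.
  have := odd_double_half #|D|; lia.
rewrite sumn_nseq mul1n => ->.
rewrite -cards_draws -size_filter cardE; congr size.
rewrite {1}/enum_mem -filter_predI; apply: eq_filter => x.
by rewrite /= !inE andbC.
Qed.

(** * Coloring with few Berge-free classes *)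

Lemma min_colors_le_coloring (n : nat) (G : sgraph) (C : eqType)
    (col : {set 'I_n} -> C) (s : seq C) :
  (forall x, col x \in s) ->
  (forall c, berge_free G [set x | col x == c]) ->
  min_colors n G <= size s.
Proof.
move=> cols colF.
apply: leq_trans (min_colors_le (P := preim_partition col [set: {set 'I_n}]) _) _.
  rewrite /free_partition preim_partitionP; apply/forall_inP => _ /imsetP[x _ ->].
  rewrite [X in berge_free G X](_ : _ = [set y | col y == col x]) //.
  by apply/setP => y; rewrite !inE eq_sym.
rewrite cardE -(size_map (fun c => [set y | c == col y])).
apply: uniq_leq_size (enum_uniq _) _ => F.
rewrite mem_enum => /imsetP[x _ ->]; apply/mapP; exists (col x) => //.
by apply/setP => y; rewrite !inE.
Qed.

(** Two edges of [G] with a common vertex [v] are sent to hyperedges that both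
contain the image of [v], hence to the same side.  By connectedness all the
hyperedges of a Berge copy are on one side, which has too few members. *)
Lemma berge_free_two_sides (G : sgraph) (W : finType) (F : {set {set W}})
    (side : pred {set W}) :
  (forall u v : G, connect (@adj G) u v) ->
  (forall b, #|[set x in F | side x == b]| < #|edges G|) ->
  {in F &, forall x y, side x -> ~~ side y -> [disjoint x & y]} ->
  berge_free G F.
Proof.
move=> Gconn Flt Fdis; apply/forallP => H; apply/implyP => HF; apply/negP.
case/existsP => phi /existsP[g /and4P[_ /dinjectiveP gI /eqP gH /forall_inP gP]].
have gF e : e \in edges G -> g e \in F.
  by move=> eG; apply: (subsetP HF); rewrite -gH imset_f.
have sideE e f v : e \in edges G -> f \in edges G -> v \in e -> v \in f ->
    side (g e) = side (g f).
  move=> eG fG ve vf; apply: contraTeq isT => ne.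
  have nd x y (xG : x \in edges G) (yG : y \in edges G) : v \in x -> v \in y ->
      side (g x) -> ~~ side (g y) -> false.
    move=> vx vy sx sy; have /pred0P/(_ (phi v)) /= := Fdis _ _ (gF _ xG) (gF _ yG) sx sy.
    by rewrite (subsetP (gP _ xG)) ?imset_f // (subsetP (gP _ yG)) ?imset_f.
  case se: (side (g e)) ne; case sf: (side (g f)) => //= _.
    by rewrite (nd e f) ?sf.
  by rewrite (nd f e) ?se.
pose t v := [exists e in edges G, (v \in e) && side (g e)].
have tE e v : e \in edges G -> v \in e -> t v = side (g e).
  move=> eG ve; apply/exists_inP/idP => [[f fG /andP[vf]]|se].
    by rewrite (sideE _ _ _ fG eG vf ve).
  by exists e => //; rewrite ve.
have tconst u v : t u = t v.
  have /connectP[p + ->] := Gconn u v.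
  elim: p u => //= w p IH u /andP[uw /IH <-].
  have eG : [set u; w] \in edges G by apply/imsetP; exists (u, w); rewrite ?inE.
  by rewrite (tE _ u eG) ?(tE _ w eG) // !inE eqxx ?orbT.
have [e0 e0G] : exists e, e \in edges G.
  by apply/set0Pn; rewrite -card_gt0; apply: leq_ltn_trans (Flt true).
have edge_ne e : e \in edges G -> exists v, v \in e.
  by case/imsetP => -[u v] _ -> /=; exists u; rewrite !inE eqxx.
have [v0 v0e] := edge_ne _ e0G.
have := Flt (t v0); rewrite ltnNge => /negP; apply.
rewrite -(card_in_imset gI); apply/subset_leq_card/subsetP => _ /imsetP[e eG ->].
have [v ve] := edge_ne _ eG.
by rewrite inE gF //= -(tE _ _ eG ve) (tconst v v0).
Qed.

(** Each chain of [l] sets uses at most [l / (k - 1) + 2] colors: its blocks,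
plus one for the shift between the two sides and one for rounding. *)
Lemma min_colors_upper (m k : nat) (G : sgraph) :
  1 < k -> #|edges G| = k -> (forall u v : G, connect (@adj G) u v) ->
  (k - 1) * min_colors m.+1 G <= 2 ^ m + 2 * (k - 1) * 'C(m, m./2).
Proof.
move=> k1 Gk Gconn.
pose D := [set~ (ord0 : 'I_m.+1)].
have cD : #|D| = m by rewrite cardsC1 card_ord.
have [cs [csD szcs cs_sorted]] := chain_decomposition D.
rewrite cD in szcs.
(* [base] is a bijection onto the subsets of [D] on either side; it is decreasing
   on the sets that avoid [ord0], which makes the two sides of a class disjoint. *)
pose base (x : {set 'I_m.+1}) := if ord0 \in x then x :\ ord0 else D :\: x.
have baseD x : base x \subset D.
  by rewrite /base; case: ifP => _; apply/subsetP => y; rewrite !inE => /andP[].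
pose chain x := nth [::] cs (find (fun c => base x \in c) cs).
have chainP x : chain x \in cs /\ base x \in chain x.
  have hx : has (fun c => base x \in c) cs.
    have : base x \in flatten cs by rewrite (perm_mem csD) mem_enum inE.
    by case/flattenP => c c_cs xc; apply/hasP; exists c.
  by split; [rewrite mem_nth // -has_find | exact: (nth_find [::] hx)].
pose rk x := index (base x) (chain x).
(* A block of complements is paired with the block of rank one less, hence the
   shift by one of the sets that contain [ord0]. *)
pose col x := (chain x, rk x %/ (k - 1) + (ord0 \in x)).
pose s := [seq (c, j) | c <- cs, j <- iota 0 (size c %/ (k - 1) + 2)].
have szs : (k - 1) * size s <= 2 ^ m + 2 * (k - 1) * 'C(m, m./2).
  have -> : 2 ^ m = sumn (map size cs).
    by rewrite -size_flatten (perm_size csD) -cardE card_powerset cD.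
  rewrite -szcs size_allpairs_dep; elim: (cs) => [|c s' IH] /=; first by rewrite muln0.
  rewrite size_iota; have := leq_trunc_div (size c) (k - 1); move: IH.
  set A := sumn _; set B := sumn _; set Q := _ %/ _; set K := k - 1; nia.
apply: leq_trans szs; rewrite leq_mul2l; apply/orP; right.
apply: (min_colors_le_coloring (col := col)) => [x|[c j]].
  have [xcs xc] := chainP x.
  apply/allpairsPdep; exists (chain x), (col x).2; split=> //.
  rewrite mem_iota add0n /=; have : rk x < size (chain x) by rewrite index_mem.
  move=> /ltnW/(leq_div2r (k - 1)); case: (ord0 \in x); lia.
apply: (berge_free_two_sides (side := fun x => ord0 \in x)) => // [b|x y].
  rewrite Gk; have [q kq] : exists q, k = q.+2 by exists (k - 2); lia.
  have q1 : k - 1 = q.+1 by lia.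
  suff: #|[set x in [set x | col x == (c, j)] | (ord0 \in x) == b]| <= #|'I_q.+1|.
    by rewrite card_ord kq ltnS.
  apply: (@leq_card_in _ _ (fun x => inord (rk x %% q.+1))) => x y.
  rewrite !inE !xpair_eqE => /andP[/andP[/eqP xc /eqP xj] /eqP xb].
  move=> /andP[/andP[/eqP yc /eqP yj] /eqP yb] /(congr1 val) /=.
  rewrite !inordK ?ltn_mod // => xy.
  have rE : rk x = rk y.
    rewrite (divn_eq (rk x) q.+1) (divn_eq (rk y) q.+1) xy; congr (_ * _ + _).
    by move: xj yj; rewrite xb yb q1; lia.
  have bE : base x = base y.
    have [_ xm] := chainP x; have [_ ym] := chainP y.
    have [xm' ym'] : base x \in c /\ base y \in c by rewrite -{1}xc -yc.
    rewrite -(nth_index set0 xm') -(nth_index set0 ym'); congr nth.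
    by move: rE; rewrite /rk xc yc.
  have := bE; rewrite /base xb yb; case: b xb yb => xb yb.
    by move=> E; rewrite -(setD1K xb) -(setD1K yb) E.
  move=> /setP E; apply/setP => z; have := E z; rewrite !inE.
  case: eqP => [->|_ /=]; first by rewrite xb yb.
  by rewrite !andbT => /negb_inj.
rewrite !inE !xpair_eqE => /andP[/eqP xc /eqP xj] /andP[/eqP yc /eqP yj] x0 y0.
have [xcs xm] := chainP x; have [_ ym] := chainP y.
have sub : base x \subset base y.
  rewrite xc in xcs xm; rewrite yc in ym.
  have tr : transitive (fun x y : {set 'I_m.+1} => x \subset y).
    by move=> ? ? ?; apply: subset_trans.
  apply: (sorted_ltn_index tr (cs_sorted _ xcs)) => //.
  have : rk x %/ (k - 1) < rk y %/ (k - 1) by move: xj yj; rewrite x0 (negPf y0); lia.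
  rewrite /rk xc yc; apply: contraTT; rewrite -!leqNgt; exact: leq_div2r.
rewrite /base x0 (negPf y0) in sub.
apply/pred0P => z /=; apply/negP => /andP[zx zy].
have := subsetP sub z; rewrite !inE zx zy andbT /=.
by case: eqP zy => [->|_ _ /(_ isT)//]; rewrite (negPf y0).
Qed.

(** * Few large sets in a Berge-free family *)

Lemma exists_subset_card (T : finType) (A : {set T}) (m : nat) : m <= #|A| ->
  exists2 B : {set T}, B \subset A & #|B| = m.
Proof.
move=> mA; exists [set x in take m (enum A)].
  by apply/subsetP => x; rewrite inE => /mem_take; rewrite mem_enum.
by rewrite cardsE (card_uniqP _) ?take_uniq ?enum_uniq // size_takel -?cardE.
Qed.

Lemma leq_card_bigcup (I T : finType) (P : pred I) (F : I -> {set T}) :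
  #|\bigcup_(i | P i) F i| <= \sum_(i | P i) #|F i|.
Proof.
elim/big_ind2: _ => [|m A n B Am Bn|//]; first by rewrite cards0.
by apply: (leq_trans (leq_card_setU A B)); apply: leq_add.
Qed.

(** Any injection of the vertices into the common part works, with any bijection
between the edges and the hyperedges. *)
Lemma berge_common_core (G : sgraph) (W : finType) (K : {set {set W}}) :
  #|K| = #|edges G| -> #|G| <= #|\bigcap_(x in K) x| -> berge G K.
Proof.
move=> KG Gcore; set core := \bigcap_(x in K) x in Gcore.
have lt_core (v : G) : enum_rank v < #|core| by apply: leq_trans Gcore.
have lt_K e : e \in edges G -> index e (enum (edges G)) < size (enum K).
  by move=> eG; rewrite -cardE KG cardE index_mem mem_enum.
pose phi := [ffun v : G => enum_val (Ordinal (lt_core v))].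
pose g := [ffun e : {set G} => nth set0 (enum K) (index e (enum (edges G)))].
have gI : {in edges G &, injective g}.
  move=> e f eG fG; rewrite !ffunE => /eqP.
  rewrite nth_uniq ?enum_uniq ?lt_K // => /eqP E.
  by rewrite -(nth_index e (s := enum (edges G)) (x := e)) ?mem_enum // E nth_index ?mem_enum.
have gK e : e \in edges G -> g e \in K.
  by move=> eG; rewrite ffunE -mem_enum mem_nth ?lt_K.
apply/existsP; exists phi; apply/existsP; exists g; apply/and4P; split.
- apply/injectiveP => u v; rewrite !ffunE => /enum_val_inj/(congr1 val) /= E.
  by apply: enum_rank_inj; apply: val_inj.
- exact/dinjectiveP.
- rewrite eqEcard card_in_imset // KG leqnn andbT.
  by apply/subsetP => _ /imsetP[e eG ->]; apply: gK.
- apply/forall_inP => e eG; apply/subsetP => _ /imsetP[v _ ->].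
  rewrite ffunE; have /bigcapP/(_ _ (gK e eG)) // := enum_valP (Ordinal (lt_core v)).
Qed.

(** Double counting of the incidences: a point outside all the [k]-fold
intersections lies in at most [k - 1] members of [F], and there are at most
[2 ^ #|F| * c] other points. *)
Lemma sum_card_le_core (W : finType) (F : {set {set W}}) (k c : nat) :
  0 < k ->
  (forall K : {set {set W}}, K \subset F -> #|K| = k -> #|\bigcap_(x in K) x| <= c) ->
  \sum_(x in F) #|x| <= (k - 1) * #|W| + #|F| * (2 ^ #|F| * c).
Proof.
move=> k0 small.
pose T := \bigcup_(K in [set K in powerset F | #|K| == k]) \bigcap_(x in K) x.
have cT : #|T| <= 2 ^ #|F| * c.
  apply: (leq_trans (leq_card_bigcup _ _)).
  rewrite -card_powerset -sum_nat_const.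
  apply: (@leq_trans (\sum_(K in [set K in powerset F | #|K| == k]) c)).
    by apply: leq_sum => K; rewrite !inE => /andP[KF /eqP]; apply: small.
  rewrite !sum_nat_const leq_mul2r; apply/orP; right.
  by apply/subset_leq_card/subsetP => K; rewrite !inE => /andP[].
have degE v : \sum_(x in F) (v \in x) <= (k - 1) + #|F| * (v \in T).
  have -> : \sum_(x in F) (v \in x) = #|[set x in F | v \in x]|.
    by rewrite -sum1dep_card big_mkcondr /=; apply: eq_bigr => x _; case: (v \in x).
  case: (leqP k #|[set x in F | v \in x]|) => [/exists_subset_card[K KF Kk]|]; last by lia.
  have -> : v \in T.
    apply/bigcupP; exists K.
      rewrite !inE Kk eqxx andbT; apply: subset_trans KF _.
      by apply/subsetP => x; rewrite inE => /andP[].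
    by apply/bigcapP => x /(subsetP KF); rewrite inE => /andP[].
  rewrite muln1; apply: leq_trans (leq_addl _ _); apply/subset_leq_card/subsetP => x.
  by rewrite inE => /andP[].
have -> : \sum_(x in F) #|x| = \sum_v \sum_(x in F) (v \in x).
  rewrite exchange_big; apply: eq_bigr => x _.
  by rewrite -sum1_card big_mkcond; apply: eq_bigr => v _; case: (v \in x).
apply: (@leq_trans (\sum_(v : W) ((k - 1) + #|F| * (v \in T)))).
  by apply: leq_sum => v _; apply: degE.
rewrite big_split /= sum_nat_const mulnC leq_add2l -big_distrr /= leq_mul2l.
apply/orP; right; apply: leq_trans cT.
by rewrite -sum1_card [in X in _ <= X]big_mkcond; apply: leq_sum => v _; case: (v \in T).
Qed.

(** The size condition says that [x] has at least [n / 2 - n / 4k] points, where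
[n = #|W|].  It is chosen so that [2k - 1] such sets exceed the bound of
[sum_card_le_core] by a multiple of [n]:
[(2 k - 1) ^ 2 = 4 k (k - 1) + 1]. *)
Lemma berge_free_big_sets (G : sgraph) (W : finType) (F : {set {set W}}) (k : nat) :
  0 < k -> #|edges G| = k -> #|G| <= k.+1 ->
  4 * k * (2 * k - 1) * 2 ^ (2 * k - 1) * k < #|W| ->
  {in F, forall x : {set W}, (2 * k - 1) * #|W| <= 4 * k * #|x|} ->
  berge_free G F -> #|F| <= 2 * (k - 1).
Proof.
move=> k0 Gk Gv Wbig Fbig /forallP Ffree; rewrite leqNgt; apply/negP => Flt.
have [|F' F'F F'c] := @exists_subset_card _ F (2 * k - 1); first lia.
have /(sum_card_le_core k0) : forall K : {set {set W}}, K \subset F' -> #|K| = k ->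
    #|\bigcap_(x in K) x| <= k.
  move=> K KF' Kk; rewrite leqNgt; apply/negP => core.
  have /implyP/(_ (subset_trans KF' F'F))/negP := Ffree K; apply.
  by apply: berge_common_core; [rewrite Gk | apply: leq_trans core].
rewrite F'c => up.
have : \sum_(x in F') (2 * k - 1) * #|W| <= \sum_(x in F') 4 * k * #|x|.
  by apply: leq_sum => x /(subsetP F'F); apply: Fbig.
rewrite sum_nat_const -big_distrr /= F'c => low.
have {low up} : (2 * k - 1) * ((2 * k - 1) * #|W|) <=
    4 * k * ((k - 1) * #|W| + (2 * k - 1) * (2 ^ (2 * k - 1) * k)).
  by apply: leq_trans low _; rewrite leq_mul2l up orbT.
move: Wbig; set E := 2 ^ _; set n := #|W|.
have [q ->] : exists q, k = q.+1 by exists k.-1; lia.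
have -> : 2 * q.+1 - 1 = 2 * q + 1 by lia.
have -> : q.+1 - 1 = q by lia.
nia.
Qed.

(** * Most sets have size close to half *)

Import GRing.Theory Num.Theory.

(** The variance of the cardinal of a uniformly random subset, multiplied by
[4 * 2 ^ #|D|]. *)
Lemma sum_powerset_deviation (T : finType) (D : {set T}) :
  (\sum_(x in powerset D) (#|D|%:Z - 2 * #|x|%:Z) ^+ 2 = #|D|%:Z * 2 ^+ #|D|)%R.
Proof.
have [d] := ubnP #|D|; elim: d => // d IH in D *.
have [->|[a aD]] := set_0Vmem D => [_|].
  by rewrite powerset0 big_set1 cards0.
rewrite ltnS => dD.
have cD := cardsD1 a D; rewrite aD add1n in cD.
have /IH {}IH : #|D :\ a| < d by rewrite -ltnS -cD ltnS.
have aD' : a \notin D :\ a by rewrite !inE eqxx.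
rewrite cD -{1}(setD1K aD) -big_enum (perm_big _ (perm_enum_powersetU1 aD')) /=.
rewrite big_cat big_map /= !big_enum /= -big_split /=.
set m := #|D :\ a| in IH *.
rewrite (eq_bigr (fun x : {set T} => 2 * (m%:Z - 2 * #|x|%:Z) ^+ 2 + 2)%R); last first.
  move=> x; rewrite inE => xD.
  have ax : a \notin x by apply: contraNN aD' => /(subsetP xD).
  by rewrite cardsU1 ax add1n !intS; ring.
rewrite big_split /= -big_distrr /= IH sumr_const card_powerset -/m.
by rewrite exprS -[X in (_ + X)%R]mulr_natr natrX intS; ring.
Qed.

(** Chebyshev's inequality: a set counted here satisfies
[#|T| < 2 * k * (#|T| - 2 * #|x|)]. *)
Lemma card_small_sets (T : finType) (k : nat) : 0 < k ->
  #|[set x : {set T} | 4 * k * #|x| < (2 * k - 1) * #|T|]| * #|T| <= 4 * k ^ 2 * 2 ^ #|T|.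
Proof.
move=> k0; set S := [set x | _]; set n := #|T|.
have [n0|n0] := posnP n; first by rewrite n0 muln0.
have := sum_powerset_deviation [set: T]; rewrite powersetT cardsT -/n => E.
have key : (\sum_(x in S) n%:Z ^+ 2 <=
    \sum_(x in [set: {set T}]) (4 * k ^ 2)%N%:Z * (n%:Z - 2 * #|x|%:Z) ^+ 2)%R.
  rewrite [X in (X <= _)%R]big_mkcond [X in (_ <= X)%R]big_mkcond /=.
  apply: ler_sum => x _; rewrite !inE; case: ifP => [xS|_]; last first.
    by rewrite mulr_ge0 ?sqr_ge0.
  have {xS} dev : (n%:Z <= (2 * k)%N%:Z * (n%:Z - 2 * #|x|%:Z))%R by nia.
  have -> : ((4 * k ^ 2)%N%:Z = (2 * k)%N%:Z ^+ 2)%R by lia.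
  by rewrite -exprMn; apply: lerXn2r; rewrite // nnegrE; lia.
rewrite sumr_const -big_distrr /= E in key.
have e2 : ((2 ^ n)%N%:Z = 2 ^+ n)%R by rewrite -natz natrX.
rewrite -(leq_pmul2r n0) -lez_nat !(PoszM _ n) PoszM e2.
rewrite [X in (X <= _)%R](_ : _ = n%:Z ^+ 2 *+ #|S|)%R; last by rewrite -mulr_natr natz; ring.
by rewrite [X in (_ <= X)%R](_ : _ = (4 * k ^ 2)%N%:Z * (n%:Z * 2 ^+ n))%R //; ring.
Qed.

(** * The lower bound *)

Lemma min_colors_lower (n k : nat) (G : sgraph) :
  1 < k -> #|edges G| = k -> #|G| <= k.+1 ->
  4 * k * (2 * k - 1) * 2 ^ (2 * k - 1) * k < n ->
  2 ^ n * n <= 2 * (k - 1) * min_colors n G * n + 4 * k ^ 2 * 2 ^ n.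
Proof.
move=> k1 Gk Gv nbig; have k0 : 0 < k by apply: ltnW.
have [|P Pfree <-] := @min_colorsP n G; first by rewrite Gk.
case/andP: Pfree => Ppart /forall_inP Pfree.
have := @card_small_sets 'I_n k k0; rewrite card_ord.
set S := [set x | _] => Sle.
have : #|~: S| <= #|P| * (2 * (k - 1)).
  have [/eqP Pcov Ptriv _] := and3P Ppart.
  have -> : ~: S = \bigcup_(F in P) (F :\: S).
    apply/setP => x; apply/idP/bigcupP => [xS|[F _]]; last by rewrite !inE => /andP[].
    have : x \in cover P by rewrite Pcov inE.
    by case/bigcupP => F FP xF; exists F => //; rewrite inE xF andbT -in_setC.
  apply: (leq_trans (leq_card_bigcup _ _)); rewrite -sum_nat_const; apply: leq_sum => F FP.
  apply: (berge_free_big_sets k0 Gk Gv); rewrite ?card_ord //.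
    by move=> x; rewrite !inE -leqNgt => /andP[].
  apply/forallP => H; apply/implyP => HF.
  have /forallP/(_ H)/implyP := Pfree F FP; apply.
  exact: subset_trans HF (subsetDl _ _).
have := cardsC S; rewrite -cardsT -powersetT card_powerset cardsT card_ord.
nia.
Qed.

(** * Edges and connectedness of cycles, paths and stars *)

Lemma connected_from_root (G : sgraph) (r : G) :
  (forall v, connect (@adj G) r v) -> forall u v, connect (@adj G) u v.
Proof.
move=> rconn u v; apply: connect_trans (rconn v).
by rewrite (sym_connect_sym (@adj_sym G)).
Qed.

Lemma connected_from_ord0 (k : nat) (e : rel 'I_k.+1) :
  (forall i j : 'I_k.+1, i.+1 = j :> nat -> e i j) -> forall v, connect e ord0 v.
Proof.
move=> eS [m]; elim: m => [|m IH] lt_mk; first by rewrite (_ : Ordinal _ = ord0) //; apply: val_inj.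
by apply: connect_trans (IH (ltnW lt_mk)) _; apply/connect1/eS.
Qed.

Lemma set2_eq (T : finType) (a b c d : T) :
  [set a; b] = [set c; d] -> (a = c /\ b = d) \/ (a = d /\ b = c).
Proof.
move=> /setP E.
have := E a; have := E b; have := E c; have := E d; rewrite !inE !eqxx ?orbT /=.
move=> /orP[/eqP dE|/eqP dE] /orP[/eqP cE|/eqP cE]
  /esym/orP[/eqP bE|/eqP bE] /esym/orP[/eqP aE|/eqP aE]; subst; auto.
Qed.

Lemma path_connected (k : nat) (u v : path_graph k) : connect (@adj (path_graph k)) u v.
Proof.
apply: (@connected_from_root (path_graph k) ord0) => {}v.
by apply: connected_from_ord0 => i j /eqP ij; rewrite /= /path_adj ij.
Qed.

Lemma star_connected (k : nat) (u v : star_graph k) : connect (@adj (star_graph k)) u v.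
Proof.
apply: (@connected_from_root (star_graph k) ord0) => {}v.
case: (eqVneq v ord0) => [->|v0]; first exact: connect0.
by apply: connect1; rewrite /= /star_adj eqxx (negPf v0).
Qed.

Lemma cycle_connected (k : nat) (u v : cycle_graph k) : connect (@adj (cycle_graph k)) u v.
Proof.
case: k u v => [[]//|k] u v.
apply: (@connected_from_root (cycle_graph k.+1) ord0) => {u}v.
apply: connected_from_ord0 => i j ij; rewrite /= /cycle_adj.
have -> : j = ordS i by apply: val_inj; rewrite /= -ij modn_small // ij.
rewrite eqxx andbT -val_eqE /=; rewrite modn_small ?ij //; lia.
Qed.

Lemma card_edges_path (k : nat) : #|edges (path_graph k)| = k.
Proof.
pose f (i : 'I_k) : {set path_graph k} := [set widen_ord (leqnSn k) i; lift ord0 i].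
have -> : edges (path_graph k) = [set f i | i in 'I_k].
  apply/setP => e; apply/imsetP/imsetP => [[[u v] /= uv ->]|[i _ ->]].
    wlog uv' : u v uv / u.+1 = v :> nat.
      move=> W; move: uv; rewrite inE => /= /orP[/eqP E|/eqP E].
        by apply: (W _ _ _ E); rewrite inE /= /path_adj E eqxx.
      by rewrite setUC; apply: (W _ _ _ E); rewrite inE /= /path_adj E eqxx.
    have uk : u < k by rewrite -ltnS uv'.
    exists (Ordinal uk) => //; congr [set _; _]; apply: val_inj => //=.
  exists (widen_ord (leqnSn k) i, lift ord0 i) => //.
  by rewrite inE /= /path_adj /= eqxx.
rewrite card_imset ?card_ord // => i j /set2_eq[] [/(congr1 val) /= E1 /(congr1 val) /= E2].
  exact: val_inj.
by apply: val_inj => /=; move: E1 E2; rewrite /bump /=; lia.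
Qed.

Lemma card_edges_star (k : nat) : #|edges (star_graph k)| = k.
Proof.
pose f (i : 'I_k) : {set star_graph k} := [set ord0; lift ord0 i].
have -> : edges (star_graph k) = [set f i | i in 'I_k].
  apply/setP => e; apply/imsetP/imsetP => [[[u v] /= uv ->]|[i _ ->]].
    wlog u0 : u v uv / u == ord0.
      move=> W; move: (uv); rewrite inE /= /star_adj.
      case: (eqVneq u ord0) => [u0 _|u0]; first by apply: W => //; rewrite u0.
      case: (eqVneq v ord0) => // v0 _; rewrite setUC; apply: W; last by rewrite v0.
      by move: uv; rewrite !inE /= /star_adj eq_sym.
    move: uv; rewrite inE /= /star_adj u0 (eqP u0) => /=.
    case: (unliftP ord0 v) => [j -> _|-> //]; by exists j.
  by exists (ord0, lift ord0 i); rewrite // inE /= /star_adj eqxx.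
rewrite card_imset ?card_ord // => i j /set2_eq[] [/(congr1 val) /= E1 /(congr1 val) /= E2].
  by apply: val_inj; move: E2; rewrite /bump /=; lia.
by move: E1; rewrite /bump /=.
Qed.

Lemma card_edges_cycle (k : nat) : 2 < k -> #|edges (cycle_graph k)| = k.
Proof.
move=> k2.
pose f (i : 'I_k) : {set cycle_graph k} := [set i; ordS i].
have SE (i : 'I_k) : ordS i = (if i.+1 < k then i.+1 else 0) :> nat.
  rewrite /=; case: ltnP => ik; first by rewrite modn_small.
  have -> : i.+1 = k by have := ltn_ord i; lia.
  by rewrite modnn.
have -> : edges (cycle_graph k) = [set f i | i in 'I_k].
  apply/setP => e; apply/imsetP/imsetP => [[[u v] /= uv ->]|[i _ ->]].
    move: uv; rewrite inE /= => /andP[_ /orP[/eqP ->|/eqP ->]]; first by exists u.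
    by exists v; rewrite // setUC.
  exists (i, ordS i) => //; rewrite inE /= /cycle_adj eqxx andbT -val_eqE /=.
  by have := SE i; rewrite /= => ->; case: ifP; lia.
rewrite card_imset ?card_ord // => i j /set2_eq[] [/(congr1 val) E1 /(congr1 val) E2].
  exact: val_inj.
have := SE j; have := SE i; move: E1 E2 => /= <- ->.
have := ltn_ord i; have := ltn_ord j => /=; case: ifP; case: ifP; lia.
Qed.

Lemma graph_parameters (k : nat) (G : sgraph) :
  (3 <= k /\ G = cycle_graph k) \/ G = path_graph k \/ G = star_graph k ->
  [/\ #|edges G| = k, #|G| <= k.+1 & forall u v : G, connect (@adj G) u v].
Proof.
move=> [[k3 ->]|[->|->]]; split; rewrite ?card_ord //.
- exact: card_edges_cycle.
- exact: cycle_connected.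
- exact: card_edges_path.
- exact: path_connected.
- exact: card_edges_star.
- exact: star_connected.
Qed.

(** * Size of the central binomial coefficient *)

Lemma central_binomial_even (m : nat) : 'C(m.*2, m) ^ 2 * m.*2.+1 <= 16 ^ m.
Proof.
elim: m => // m IH.
have rec : m.+1 * 'C(m.+1.*2, m.+1) = 2 * m.*2.+1 * 'C(m.*2, m).
  have E1 := mul_bin_diag m.+1.*2 m; have E2 := mul_bin_down m.*2.+1 m.
  rewrite doubleS /= in E1 *.
  have E3 : m.*2.+1 - m = m.+1 by lia.
  by rewrite E3 /= in E2; rewrite -E1 -mulnA E2 mulnA mul2n doubleS.
have m0 : 0 < m.+1 ^ 2 by rewrite expn_gt0.
rewrite -(leq_pmul2l m0) mulnA -expnMn rec.
move: IH; set c := 'C(_, _); set p := 16 ^ m => IH.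
apply: (@leq_trans (4 * m.*2.+1 * m.+1.*2.+1 * p)).
  rewrite [X in X <= _](_ : _ = 4 * m.*2.+1 * m.+1.*2.+1 * (c ^ 2 * m.*2.+1)); last by ring.
  by rewrite leq_mul2l IH orbT.
rewrite (expnS 16) mulnA leq_mul2r; apply/orP; right; rewrite doubleS -mul2n; nia.
Qed.

(** An odd row reduces to the next even one, whose central entry is twice as
large. *)
Lemma central_binomial (n : nat) : 'C(n, n./2) ^ 2 * n.+1 <= 4 ^ n.
Proof.
have := odd_double_half n; set m := n./2; case: (odd n) => <-; rewrite ?add0n ?add1n.
  have := central_binomial_even m.+1.
  have -> : 'C(m.+1.*2, m.+1) = 2 * 'C(m.*2.+1, m).
    rewrite doubleS binS -(bin_sub (n := m.*2.+1) (m := m.+1)); last by lia.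
    have -> : m.*2.+1 - m.+1 = m by lia.
    by rewrite mul2n addnn.
  have -> : 4 ^ m.*2.+1 = 4 * 16 ^ m by rewrite expnS -mul2n expnM.
  rewrite (expnS 16) doubleS expnMn; set c := 'C(_, _); set p := 16 ^ m.
  lia.
by have := central_binomial_even m; rewrite -[in 4 ^ _]mul2n expnM.
Qed.

(** * Asymptotics *)

From mathcomp Require Import all_classical all_reals all_analysis.
Import Order.TTheory GRing.Theory Num.Theory numFieldNormedType.Exports.
Local Open Scope classical_set_scope.
Local Open Scope ring_scope.

Theorem corollary1 (R : realType) (k : nat) (hk : (2 <= k)%N) (G : sgraph)
    (hG : ((3 <= k)%N /\ G = cycle_graph k)
          \/ G = path_graph k \/ G = star_graph k) :
  exists a b : nat -> R,
    [/\ a n @[n --> \oo] --> 0,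
        b n @[n --> \oo] --> 0
      & forall n : nat,
          2 ^+ n / (2 * (k%:R - 1)) * (1 - a n) <= (min_colors n G)%:R
          /\ (min_colors n G)%:R <= 2 ^+ n / (2 * (k%:R - 1)) * (1 + b n)].
Proof.
have [Gk Gv Gconn] := graph_parameters hG.
have kE : (k - 1)%N%:R = k%:R - 1 :> R by rewrite natrB // ltnW.
have k1 : 0 < k%:R - 1 :> R by rewrite -kE ltr0n subn_gt0.
(* [r] is the relative error of the approximation: it serves as [b], and its
   opposite as [a], so that both inequalities are equalities. *)
pose r n : R := (min_colors n G)%:R * (2 * (k%:R - 1)) / 2 ^+ n - 1.
have rE n : 2 ^+ n / (2 * (k%:R - 1)) * (1 + r n) = (min_colors n G)%:R.
  rewrite /r [1 + _]addrC subrK; field.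
  by rewrite expf_neq0 ?pnatr_eq0 //= gt_eqF.
suff r0 : r n @[n --> \oo] --> 0.
  exists (fun n => - r n), r; split=> // [|n]; last by rewrite opprK rE.
  by rewrite -[X in _ --> X]oppr0; apply: cvgN.
have upper m : r m.+1 <= 2 * (k%:R - 1) * Num.sqrt (m.+1%:R^-1).
  have p0 : 0 < 2 ^+ m :> R by rewrite exprn_gt0.
  have := min_colors_upper m hk Gk Gconn.
  rewrite -(ler_nat R) !(natrD, natrM, natrX) kE => up.
  have cb : ('C(m, m./2))%:R / 2 ^+ m <= Num.sqrt (m.+1%:R^-1) :> R.
    have c0 : 0 <= ('C(m, m./2))%:R / 2 ^+ m :> R by rewrite divr_ge0 // ltW.
    rewrite -(ger0_norm c0) -sqrtr_sqr ler_wsqrtr //.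
    rewrite expr_div_n -exprM mulnC exprM ler_pdivrMr ?exprn_gt0 // mulrC.
    rewrite ler_pdivlMr ?ltr0n //; have := central_binomial m.
    by rewrite -(ler_nat R) natrM !natrX -(natrX _ 2 2).
  apply: (@le_trans _ _ (2 * (k%:R - 1) * (('C(m, m./2))%:R / 2 ^+ m))); last first.
    by rewrite ler_wpM2l // mulr_ge0 // ltW.
  rewrite /r lerBlDr exprS invfM -(ler_pM2r p0).
  rewrite [leLHS](_ : _ = (k%:R - 1) * (min_colors m.+1 G)%:R); last by field.
  rewrite [leRHS](_ : _ = 2 ^+ m + 2 * (k%:R - 1) * 'C(m, m./2)%:R) //.
  by field; rewrite gt_eqF.
have lower : \forall m \near \oo, - (4 * k%:R ^+ 2) * m.+1%:R^-1 <= r m.+1.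
  exists (4 * k * (2 * k - 1) * 2 ^ (2 * k - 1) * k)%N => // m /= mbig.
  have p0 : 0 < 2 ^+ m.+1 :> R by rewrite exprn_gt0.
  have m0 : 0 < m.+1%:R :> R by rewrite ltr0n.
  have := min_colors_lower hk Gk Gv (leq_ltn_trans mbig (ltnSn m)).
  rewrite -(ler_nat R) !(natrD, natrM, natrX) kE => low.
  rewrite /r -(ler_pM2r p0) -(ler_pM2r m0) mulrBl mulfVK ?gt_eqF // mul1r.
  rewrite [leLHS](_ : _ = - (4 * k%:R ^+ 2 * 2 ^+ m.+1)); last first.
    by field; rewrite gt_eqF.
  rewrite -subr_ge0; move: low; rewrite -subr_ge0 => low.
  by apply: le_trans low _; rewrite le_eqVlt; apply/orP; left; apply/eqP; ring.
rewrite -cvg_shiftS.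
apply: (@squeeze_cvgr _ _ _ _ (fun m => - (4 * k%:R ^+ 2) * m.+1%:R^-1)
   (fun m => 2 * (k%:R - 1) * Num.sqrt (m.+1%:R^-1))).
- by near=> m; rewrite upper andbT; near: m.
- rewrite -[X in _ --> X](mulr0 (- (4 * k%:R ^+ 2))).
  by apply: cvgMr; exact: cvg_harmonic.
- rewrite -[X in _ --> X](mulr0 (2 * (k%:R - 1))) -sqrtr0.
  apply: cvgMr; apply: cvg_comp; first exact: cvg_harmonic.
  exact: sqrt_continuous.
Unshelve. all: by end_near.
Qed.
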